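(* For each $\alpha\in(1,2)$ let $(\lambda_1,\lambda_2,\lambda_3)$ be a real triple (possibly depending on $\alpha$) chosen in the set $\mathcal{S}_1$ or $\mathcal{S}_2$ or $\mathcal{S}_3$, and assume that $$Q(\theta,\alpha;\lambda_1,\lambda_2,\lambda_3)=\Big(2\sin\frac{\theta}{2}\Big)^{\alpha}\Big(\lambda_1\cos\big(\tfrac{\alpha}{2}(\theta-\pi)-\theta\big)+\lambda_2\cos\big(\tfrac{\alpha}{2}(\theta-\pi)\big)+\lambda_3\cos\big(\tfrac{\alpha}{2}(\theta-\pi)+\theta\big)\Big)\le 0$$ for all $\theta\in[0,\pi]$ and $1<\alpha<2$. Then the Crank–Nicolson–WSGD scheme $$\frac{U_j^{n+1}-U_j^n}{\tau}+v_x\frac{U_{j+1}^{n}-U_{j-1}^{n}}{4h}-\Big(\frac{d_x}{2h^{\alpha}}\sum_{k=0}^{j+1}g_k^{(\alpha)}U_{j-k+1}^{n}+\frac{d_x}{2h^{\alpha}}\sum_{k=0}^{N_x-j+1}g_k^{(\alpha)}U_{j+k-1}^{n}\Big)$$ $$=-v_x\frac{U_{j+1}^{n+1}-U_{j-1}^{n+1}}{4h}+\frac{d_x}{2h^{\alpha}}\sum_{k=0}^{j+1}g_k^{(\alpha)}U_{j-k+1}^{n+1}+\frac{d_x}{2h^{\alpha}}\sum_{k=0}^{N_x-j+1}g_k^{(\alpha)}U_{j+k-1}^{n+1}+\frac12\big(f_j^{n+1}+f_j^{n}\big)$$ is unconditionally von Neumann stable.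
   Context: The scheme discretizes the problem $u_t+v_x\partial_x u=d_x({}_aD_x^{\alpha}+{}_xD_b^{\alpha})u+f$ on $(a,b)\times[0,T]$ with initial data and Dirichlet boundary data, where $1<\alpha<2$ and $v_x>0$, $d_x>0$ are constants, and ${}_aD_x^{\alpha}$, ${}_xD_b^{\alpha}$ are the left and right Riemann–Liouville derivatives. Here $\tau>0$ is the time step, $h=(b-a)/N_x$ the space step, $x_j=a+jh$, $t_n=n\tau$, $f_j^n=f(x_j,t_n)$, and $U_j^n$ is the approximation of $u(x_j,t_n)$. Weights: $w_k^{(\alpha)}=(-1)^k\binom{\alpha}{k}=\frac{\Gamma(k-\alpha)}{\Gamma(-\alpha)\Gamma(k+1)}$, and $g_0^{(\alpha)}=\lambda_1w_0^{(\alpha)}$, $g_1^{(\alpha)}=\lambda_1w_1^{(\alpha)}+\lambda_2w_0^{(\alpha)}$, $g_k^{(\alpha)}=\lambda_1w_k^{(\alpha)}+\lambda_2w_{k-1}^{(\alpha)}+\lambda_3w_{k-2}^{(\alpha)}$ for $k\ge2$. Parameter sets (three parametrizations of the real solutions of $\lambda_1+\lambda_2+\lambda_3=1$, $\lambda_1-\lambda_3=\frac{\alpha}{2}$): $\mathcal{S}_1$: $\lambda_1$ given, $\lambda_2=\frac{2+\alpha}{2}-2\lambda_1$, $\lambda_3=\lambda_1-\frac{\alpha}{2}$; $\mathcal{S}_2$: $\lambda_2$ given, $\lambda_1=\frac{2+\alpha}{4}-\frac{\lambda_2}{2}$, $\lambda_3=\frac{2-\alpha}{4}-\frac{\lambda_2}{2}$;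 $\mathcal{S}_3$: $\lambda_3$ given, $\lambda_1=\frac{\alpha}{2}+\lambda_3$, $\lambda_2=\frac{2-\alpha}{2}-2\lambda_3$. Von Neumann stability: consider the perturbation (error) equation of the scheme, i.e. the scheme with $f=0$, extended by zero to the whole lattice so that all upper summation limits $j+1$ and $N_x-j+1$ are replaced by $\infty$ and $j\in\mathbb{Z}$. Inserting $\epsilon_j^n=\rho^n e^{ij\theta}$ ($i=\sqrt{-1}$) determines the amplification factor $\rho=\rho(\theta)$. The scheme is unconditionally von Neumann stable if, for every $\tau>0$ and $h>0$, $|\rho(\theta)|\le1$ for all $\theta\in[-\pi,\pi]$. *)

(* Defs.v *)
From Stdlib Require Import Reals ZArith Lia Lra.
From Coquelicot Require Import Coquelicot.

Open Scope R_scope.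

(** [x ^ a] for a real exponent [a] and a base [x >= 0], with [0 ^ a = 0];
    [Rpower 0 a] is [1] because of the convention [ln 0 = 0]. *)
Definition real_pow (x a : R) : R :=
  if Req_EM_T x 0 then 0 else Rpower x a.

Fixpoint falling (a : R) (k : nat) : R :=
  match k with
  | O => 1
  | S k' => falling a k' * (a - INR k')
  end.

Definition gbinom (a : R) (k : nat) : R := falling a k / INR (fact k).

Definition weight_w (alpha : R) (k : nat) : R := (-1) ^ k * gbinom alpha k.

Definition weight_g (alpha l1 l2 l3 : R) (k : nat) : R :=
  match k with
  | O => l1 * weight_w alpha 0
  | S O => l1 * weight_w alpha 1 + l2 * weight_w alpha 0
  | S (S m) =>
      l1 * weight_w alpha (S (S m)) + l2 * weight_w alpha (S m)
      + l3 * weight_w alpha m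
  end.

Definition in_S1 (alpha l1 l2 l3 : R) : Prop :=
  l2 = (2 + alpha) / 2 - 2 * l1 /\ l3 = l1 - alpha / 2.

Definition in_S2 (alpha l1 l2 l3 : R) : Prop :=
  l1 = (2 + alpha) / 4 - l2 / 2 /\ l3 = (2 - alpha) / 4 - l2 / 2.

Definition in_S3 (alpha l1 l2 l3 : R) : Prop :=
  l1 = alpha / 2 + l3 /\ l2 = (2 - alpha) / 2 - 2 * l3.

Definition Q (theta alpha l1 l2 l3 : R) : R :=
  real_pow (2 * sin (theta / 2)) alpha
  * (l1 * cos (alpha / 2 * (theta - PI) - theta)
     + l2 * cos (alpha / 2 * (theta - PI))
     + l3 * cos (alpha / 2 * (theta - PI) + theta)).

Definition left_term (g : nat -> R) (U : Z -> C) (j : Z) (k : nat) : C :=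
  Cmult (RtoC (g k)) (U (j - Z.of_nat k + 1)%Z).

Definition right_term (g : nat -> R) (U : Z -> C) (j : Z) (k : nat) : C :=
  Cmult (RtoC (g k)) (U (j + Z.of_nat k - 1)%Z).

(** The Crank-Nicolson identity at node [j] between two time levels [U0]
    (old) and [U1] (new); [L0 R0 L1 R1] stand for the values of the left and
    right weighted sums at the old and new levels, and [f0 f1] for the source
    at the node. *)
Definition cn_identity (alpha vx dx tau h : R) (U0 U1 : Z -> C) (j : Z)
    (L0 R0 L1 R1 f0 f1 : C) : Prop :=
  let c : C := RtoC (dx / (2 * Rpower h alpha)) in
  ((U1 j - U0 j) / RtoC tau
   + RtoC vx * ((U0 (j + 1)%Z - U0 (j - 1)%Z) / RtoC (4 * h))
   - (c * L0 + c * R0)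
   = - (RtoC vx * ((U1 (j + 1)%Z - U1 (j - 1)%Z) / RtoC (4 * h)))
     + c * L1 + c * R1 + RtoC (1 / 2) * (f1 + f0))%C.

(** The scheme on the grid [0 <= j <= Nx], with source grid function [f]
    ([f n j] is the source at [(x_j, t_n)]). Note that [sum_n a N] is the sum
    of [a k] over [0 <= k <= N]. *)
Definition cn_wsgd_scheme (alpha : R) (g : nat -> R) (vx dx tau h : R)
    (Nx : nat) (f U : nat -> Z -> C) : Prop :=
  forall (n : nat) (j : Z), (0 < j < Z.of_nat Nx)%Z ->
    cn_identity alpha vx dx tau h (U n) (U (S n)) j
      (sum_n (left_term g (U n) j) (Z.to_nat (j + 1)))
      (sum_n (right_term g (U n) j) (Z.to_nat (Z.of_nat Nx - j + 1)))
      (sum_n (left_term g (U (S n)) j) (Z.to_nat (j + 1)))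
      (sum_n (right_term g (U (S n)) j) (Z.to_nat (Z.of_nat Nx - j + 1)))
      (f n j) (f (S n) j).

(** The same identity at one lattice node, with all upper summation limits
    replaced by infinity; the four series are required to converge. *)
Definition cn_wsgd_lattice_at (alpha : R) (g : nat -> R) (vx dx tau h : R)
    (f U : nat -> Z -> C) (n : nat) (j : Z) : Prop :=
  exists L0 R0 L1 R1 : C,
    is_series (left_term g (U n) j) L0 /\
    is_series (right_term g (U n) j) R0 /\
    is_series (left_term g (U (S n)) j) L1 /\
    is_series (right_term g (U (S n)) j) R1 /\
    cn_identity alpha vx dx tau h (U n) (U (S n)) j L0 R0 L1 R1
      (f n j) (f (S n) j).

Definition cn_wsgd_error_equation (alpha : R) (g : nat -> R)
    (vx dx tau h : R) (eps : nat -> Z -> C) : Prop :=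
  forall (n : nat) (j : Z),
    cn_wsgd_lattice_at alpha g vx dx tau h
      (fun _ _ => RtoC 0) eps n j.

(** [rho ^ n * e ^ (i j theta)] *)
Definition fourier_mode (rho : C) (theta : R) (n : nat) (j : Z) : C :=
  Cmult (Cpow rho n) (cos (IZR j * theta), sin (IZR j * theta)).

Definition is_amplification_factor (alpha : R) (g : nat -> R)
    (vx dx tau h theta : R) (rho : C) : Prop :=
  cn_wsgd_error_equation alpha g vx dx tau h (fourier_mode rho theta).

(** That the Fourier mode determines the amplification factor is part of the
    property. *)
Definition unconditionally_von_neumann_stable (alpha : R) (g : nat -> R)
    (vx dx : R) : Prop :=
  forall tau h : R, 0 < tau -> 0 < h ->
  forall theta : R, - PI <= theta <= PI ->
    (exists! rho : C, is_amplification_factor alpha g vx dx tau h theta rho) /\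
    (forall rho : C, is_amplification_factor alpha g vx dx tau h theta rho ->
       Cmod rho <= 1).

Lemma is_series_finite (a : nat -> C) (N : nat) :
  (forall k, (N < k)%nat -> a k = RtoC 0) -> is_series a (sum_n a N).
Proof.
intros H.
assert (E : forall m, sum_n a (N + m) = sum_n a N).
{ induction m as [|m IH].
  - now rewrite Nat.add_0_r.
  - rewrite Nat.add_succ_r, sum_Sn, IH, H by lia. apply Cplus_0_r. }
apply filterlim_ext_loc with (fun _ : nat => sum_n a N).
- exists N. intros n Hn. replace n with (N + (n - N))%nat by lia.
  now rewrite E.
- apply filterlim_const.
Qed.

Lemma is_series_inj (a : nat -> C) (l l' : C) :
  is_series a l -> is_series a l' -> l = l'.
Proof.
intros H H'.
exact (filterlim_locally_unique (sum_n a) l l' H H').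
Qed.

(** For a grid function extended by zero to the whole lattice, the infinite
    sums reduce to the finite ones at every interior node. *)
Lemma cn_wsgd_zero_extension (alpha : R) (g : nat -> R) (vx dx tau h : R)
    (Nx : nat) (f U : nat -> Z -> C) :
  (forall n j, (j < 0 \/ Z.of_nat Nx < j)%Z -> U n j = RtoC 0) ->
  cn_wsgd_scheme alpha g vx dx tau h Nx f U <->
  (forall n j, (0 < j < Z.of_nat Nx)%Z ->
     cn_wsgd_lattice_at alpha g vx dx tau h f U n j).
Proof.
intros HU.
assert (HL : forall n j, (0 < j < Z.of_nat Nx)%Z ->
  is_series (left_term g (U n) j)
    (sum_n (left_term g (U n) j) (Z.to_nat (j + 1)))).
{ intros n j Hj. apply is_series_finite. intros k Hk.
  unfold left_term. rewrite HU by lia. apply Cmult_0_r. }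
assert (HR : forall n j, (0 < j < Z.of_nat Nx)%Z ->
  is_series (right_term g (U n) j)
    (sum_n (right_term g (U n) j) (Z.to_nat (Z.of_nat Nx - j + 1)))).
{ intros n j Hj. apply is_series_finite. intros k Hk.
  unfold right_term. rewrite HU by lia. apply Cmult_0_r. }
split; intros H n j Hj.
- do 4 eexists. repeat split; eauto.
- destruct (H n j Hj) as (L0 & R0 & L1 & R1 & H1 & H2 & H3 & H4 & H5).
  rewrite (is_series_inj _ _ _ (HL n j Hj) H1),
    (is_series_inj _ _ _ (HR n j Hj) H2),
    (is_series_inj _ _ _ (HL (S n) j Hj) H3),
    (is_series_inj _ _ _ (HR (S n) j Hj) H4).
  exact H5.
Qed.

(* Main.v *)
Require Import Defs.
From Stdlib Require Import Reals ZArith Lia Lra.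
From Coquelicot Require Import Coquelicot.
Open Scope R_scope.

(** On a Fourier mode the shift [j -> j + m] is multiplication by
    [e^(i m theta)], so the scheme becomes a scalar equation. The left and
    right weighted sums carry conjugate symbols; their sum is [2 P] with
    [P = Re (e^(-i theta) G)], where [G = sum g_k e^(i k theta)]. With
    [c = dx / (2 h^alpha)], [p = - 2 c P] and
    [s = vx sin theta / (2 h)], the equation reads
    [rho (1/tau + p + i s) = 1/tau - p - i s].
    This is a Cayley transform: as soon as [P <= 0], hence [p >= 0], it has
    exactly one solution, and that solution lies in the closed unit disc
    ([Cayley_contraction]).

    The substance is therefore that [P] is the function [Q] of the hypothesis.
    The weights [g_k] are a three-term combination of shifts of the binomial
    weights [w_k], so
    [G = (l1 + l2 e^(i theta) + l3 e^(2 i theta)) W] with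
    [W = sum w_k e^(i k theta)]
    ([weight_g_generating_function]), and for [0 < theta <= PI] one needs the
    boundary value of the binomial series
    [W = (1 - e^(i theta))^alpha
       = (2 sin (theta/2))^alpha e^(i alpha (theta - PI) / 2)]
    ([binomial_series_circle]). It is reached from inside the disc, along a ray
    [z = r e^(i theta)]. The recurrence of the weights turns into the linear
    differential equation [(1 - z) F' = - alpha F] ([binomial_ODE]); hence
    the quotient of the series by the polar form of [(1 - z)^alpha] is constant
    for [0 <= r < 1] ([binomial_series_ray]). Since the weights are absolutely
    summable for [1 < alpha < 2], Abel's theorem allows [r -> 1].

    At [theta = 0] the polar form breaks down. There [P = sum w_k], because
    [l1 + l2 + l3 = 1], and this is nonpositive since the partial sums of the
    weights are. Negative angles follow by conjugation. *)

(** * Summability of the binomial weights *)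

Lemma weight_w_S (alpha : R) (k : nat) :
  INR (S k) * weight_w alpha (S k) = (INR k - alpha) * weight_w alpha k.
Proof.
unfold weight_w, gbinom.
rewrite fact_simpl, mult_INR; cbn [falling pow].
field; split; [apply INR_fact_neq_0 | apply not_0_INR; lia].
Qed.

Lemma weight_w_0 (alpha : R) : weight_w alpha 0 = 1.
Proof. unfold weight_w, gbinom; simpl; field. Qed.

Lemma weight_w_1 (alpha : R) : weight_w alpha 1 = - alpha.
Proof. unfold weight_w, gbinom; simpl; field. Qed.

(** The sum telescopes: by the recurrence,
    [alpha w_k = k w_k - (k + 1) w_(k + 1)]. *)
Lemma sum_weight_w (alpha : R) (n : nat) :
  alpha * sum_n (weight_w alpha) n = - (INR (S n) * weight_w alpha (S n)).
Proof.
induction n as [|n IH].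
- rewrite sum_O, weight_w_0, weight_w_1; simpl; ring.
- rewrite sum_Sn; change plus with Rplus.
  rewrite Rmult_plus_distr_l, IH, (weight_w_S alpha (S n)); ring.
Qed.

(** The factors [k - alpha] of the recurrence are positive from [k = 2] on, and
    the two negative ones, at [k = 0] and [k = 1], cancel. *)
Lemma weight_w_ge_0 (alpha : R) (k : nat) :
  1 < alpha < 2 -> 0 <= weight_w alpha (S (S k)).
Proof.
intros Ha; induction k as [|k IH].
- pose proof (weight_w_S alpha 1) as H.
  rewrite weight_w_1 in H; simpl in H; nra.
- pose proof (weight_w_S alpha (S (S k))) as H.
  pose proof (pos_INR k) as Hk.
  rewrite !S_INR in H; nra.
Qed.

Lemma sum_weight_w_le_0 (alpha : R) (n : nat) :
  1 < alpha < 2 -> sum_n (weight_w alpha) (S n) <= 0.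
Proof.
intros Ha.
pose proof (sum_weight_w alpha (S n)) as H.
pose proof (weight_w_ge_0 alpha n Ha).
pose proof (pos_INR (S (S n))).
nra.
Qed.

(** Only [w_1 = - alpha] is negative, so taking absolute values changes the
    partial sums by a constant. As the signed sums are nonpositive, this bounds
    the absolute ones. *)
Lemma sum_Rabs_weight_w (alpha : R) (n : nat) : 1 < alpha < 2 ->
  sum_n (fun k => Rabs (weight_w alpha k)) (S n)
  = sum_n (weight_w alpha) (S n) + 2 * alpha.
Proof.
intros Ha; induction n as [|n IH].
- rewrite !sum_Sn, !sum_O, weight_w_0, weight_w_1; change plus with Rplus.
  rewrite Rabs_R1, Rabs_Ropp, Rabs_pos_eq by lra; lra.
- rewrite sum_Sn, IH, (sum_Sn (weight_w alpha) (S n)); change plus with Rplus.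
  rewrite (Rabs_pos_eq (weight_w alpha (S (S n)))).
  + lra.
  + now apply weight_w_ge_0.
Qed.

Lemma ex_series_Rabs_weight_w (alpha : R) : 1 < alpha < 2 ->
  ex_series (fun k => Rabs (weight_w alpha k)).
Proof.
intros Ha; apply ex_series_incr_1.
destruct (ex_finite_lim_seq_incr
  (sum_n (fun k => Rabs (weight_w alpha (S k)))) (2 * alpha)) as [l Hl].
- intros n; rewrite sum_Sn; change plus with Rplus.
  pose proof (Rabs_pos (weight_w alpha (S (S n)))); simpl; lra.
- intros n.
  pose proof (sum_Rabs_weight_w alpha n Ha) as H.
  pose proof (sum_weight_w_le_0 alpha n Ha) as H0.
  unfold sum_n in H at 1; rewrite sum_Sn_m, <- sum_n_m_S in H by lia.
  change (sum_n_m _ 0 n)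
    with (sum_n (fun k => Rabs (weight_w alpha (S k))) n) in H.
  change plus with Rplus in H.
  pose proof (Rabs_pos (weight_w alpha 0)); lra.
- now exists l.
Qed.

Lemma ex_series_weight_w_mult (alpha : R) (u : nat -> R) : 1 < alpha < 2 ->
  (forall k, Rabs (u k) <= 1) -> ex_series (fun k => weight_w alpha k * u k).
Proof.
intros Ha Hu.
apply ex_series_Rabs, @ex_series_le with (fun k => Rabs (weight_w alpha k)).
- intros k; change norm with Rabs; rewrite Rabs_Rabsolu, Rabs_mult.
  rewrite <- (Rmult_1_r (Rabs (weight_w alpha k))) at 2.
  apply Rmult_le_compat_l; [apply Rabs_pos | apply Hu].
- now apply ex_series_Rabs_weight_w.
Qed.

(** * Power series on the unit interval *)

Lemma CV_radius_ge_1 (a : nat -> R) :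
  ex_series a -> Rbar_le 1 (CV_radius a).
Proof.
intros Ha.
destruct (filterlim_bounded a) as [M HM].
{ exists 0; now apply ex_series_lim_0. }
apply CV_radius_bounded; exists M; intros n.
rewrite pow1, Rmult_1_r; apply HM.
Qed.

Lemma lt_CV_radius (a : nat -> R) (r : R) :
  ex_series a -> 0 <= r < 1 -> Rbar_lt (Rabs r) (CV_radius a).
Proof.
intros Ha Hr; apply Rbar_lt_le_trans with 1.
- simpl; rewrite Rabs_pos_eq; lra.
- now apply CV_radius_ge_1.
Qed.

(** When the radius is exactly 1 this is Abel's theorem; when it is larger, 1 is
    an interior point and the sum is continuous there. *)
Lemma PSeries_lim_left_1 (a : nat -> R) : ex_series a ->
  filterlim (PSeries a) (at_left 1) (locally (Series a)).
Proof.
intros Ha.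
assert (E : PSeries a 1 = Series a).
{ apply Series_ext; intros n; rewrite pow1; ring. }
rewrite <- E.
destruct (Rbar_le_lt_or_eq_dec _ _ (CV_radius_ge_1 a Ha)) as [H | H].
- apply (filterlim_filter_le_1 (F := locally 1)).
  + apply filter_le_within.
  + apply continuity_pt_filterlim, PSeries_continuity.
    now rewrite Rabs_R1.
- pose proof (Abel a) as HA; rewrite <- H in HA; simpl in HA.
  apply HA; trivial; try lra.
  now apply ex_pseries_1.
Qed.

(** The Euler operator [r d/dr] multiplies the coefficients by their index. The
    series on the left has a zero term at index 0, whence the shift. *)
Lemma is_series_mult_index (a : nat -> R) (r : R) :
  Rbar_lt (Rabs r) (CV_radius a) ->
  is_series (fun k => INR k * a k * r ^ k) (r * PSeries (PS_derive a) r).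
Proof.
intros Hr; apply is_series_decr_1.
apply is_series_ext with (fun k => r * (PS_derive a k * r ^ k)).
{ intros k; unfold PS_derive.
  change (r * (INR (S k) * a (S k) * r ^ k) = INR (S k) * a (S k) * (r * r ^ k)).
  ring. }
replace (plus _ _) with (r * PSeries (PS_derive a) r)
  by (unfold plus, opp; simpl; ring).
apply (is_series_scal_l (K := R_AbsRing) (V := R_NormedModule)).
apply Series_correct, ex_series_Rabs, CV_disk_inside.
now rewrite CV_radius_derive.
Qed.

Lemma is_series_lin_comb2 (x y : R) (a b : nat -> R) (la lb : R) :
  is_series a la -> is_series b lb ->
  is_series (fun k => x * a k + y * b k) (x * la + y * lb).
Proof.
intros Ha Hb.
apply (is_series_plus (K := R_AbsRing) (V := R_NormedModule));
  apply (is_series_scal_l (K := R_AbsRing) (V := R_NormedModule)); assumption.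
Qed.

(** * The binomial series inside the unit disc *)

(** [binom_cos] and [binom_sin] are the real and imaginary parts of
    [w_k e^(i k theta)]: as power series in [r] they represent
    [(1 - r e^(i theta))^alpha]. *)
Definition binom_cos (alpha theta : R) (k : nat) : R :=
  weight_w alpha k * cos (INR k * theta).

Definition binom_sin (alpha theta : R) (k : nat) : R :=
  weight_w alpha k * sin (INR k * theta).

Lemma ex_series_binom_cos (alpha theta : R) :
  1 < alpha < 2 -> ex_series (binom_cos alpha theta).
Proof.
intros Ha; apply ex_series_weight_w_mult; trivial.
intros k; apply Rabs_le, COS_bound.
Qed.

Lemma ex_series_binom_sin (alpha theta : R) :
  1 < alpha < 2 -> ex_series (binom_sin alpha theta).
Proof.
intros Ha; apply ex_series_weight_w_mult; trivial.
intros k; apply Rabs_le, SIN_bound.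
Qed.

(** In complex form, with [F = A + i B]:
    [F' = e^(i theta) (r F' - alpha F)], which is the recurrence
    [(k + 1) w_(k + 1) = (k - alpha) w_k] read on coefficients. *)
Lemma binomial_ODE (alpha theta r : R) : 1 < alpha < 2 -> 0 <= r < 1 ->
  let A := PSeries (binom_cos alpha theta) r in
  let B := PSeries (binom_sin alpha theta) r in
  let dA := PSeries (PS_derive (binom_cos alpha theta)) r in
  let dB := PSeries (PS_derive (binom_sin alpha theta)) r in
  dA = cos theta * (r * dA - alpha * A) - sin theta * (r * dB - alpha * B) /\
  dB = sin theta * (r * dA - alpha * A) + cos theta * (r * dB - alpha * B).
Proof.
intros Ha Hr A B dA dB.
pose proof (lt_CV_radius _ r (ex_series_binom_cos alpha theta Ha) Hr) as Hc.
pose proof (lt_CV_radius _ r (ex_series_binom_sin alpha theta Ha) Hr) as Hs.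
assert (Hval : forall a, Rbar_lt (Rabs r) (CV_radius a) ->
  is_series (fun k => a k * r ^ k) (PSeries a r)).
{ intros a H; now apply Series_correct, ex_series_Rabs, CV_disk_inside. }
assert (HA := is_series_lin_comb2 1 (- alpha) _ _ _ _
  (is_series_mult_index _ _ Hc) (Hval _ Hc)).
assert (HB := is_series_lin_comb2 1 (- alpha) _ _ _ _
  (is_series_mult_index _ _ Hs) (Hval _ Hs)).
split; apply is_series_unique.
- eapply is_series_ext.
  2: { replace (_ - _) with (cos theta * (1 * (r * dA) + - alpha * A)
         + - sin theta * (1 * (r * dB) + - alpha * B)) by ring.
       exact (is_series_lin_comb2 (cos theta) (- sin theta) _ _ _ _ HA HB). }
  intros k.
  unfold PS_derive, binom_cos, binom_sin.
  replace (INR (S k) * (weight_w alpha (S k) * cos (INR (S k) * theta)))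
    with (INR (S k) * weight_w alpha (S k) * cos (INR (S k) * theta)) by ring.
  rewrite weight_w_S, S_INR, Rmult_plus_distr_r, (Rmult_1_l theta), cos_plus.
  match goal with |- ?x = ?y => change (@eq R x y) end; ring.
- eapply is_series_ext.
  2: { replace (_ + _) with (sin theta * (1 * (r * dA) + - alpha * A)
         + cos theta * (1 * (r * dB) + - alpha * B)) by ring.
       exact (is_series_lin_comb2 (sin theta) (cos theta) _ _ _ _ HA HB). }
  intros k.
  unfold PS_derive, binom_cos, binom_sin.
  replace (INR (S k) * (weight_w alpha (S k) * sin (INR (S k) * theta)))
    with (INR (S k) * weight_w alpha (S k) * sin (INR (S k) * theta)) by ring.
  rewrite weight_w_S, S_INR, Rmult_plus_distr_r, (Rmult_1_l theta), sin_plus.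
  match goal with |- ?x = ?y => change (@eq R x y) end; ring.
Qed.

(** [ray_dist2] is [|1 - r e^(i theta)|^2], and [ray_angle] is the opposite of
    the argument of [1 - r e^(i theta)]. The arctangent gives the principal
    argument because [1 - r cos theta > 0]. *)
Definition ray_dist2 (theta r : R) : R :=
  (1 - r * cos theta) ^ 2 + (r * sin theta) ^ 2.

Definition ray_angle (theta r : R) : R :=
  atan (r * sin theta / (1 - r * cos theta)).

Lemma ray_re_pos (theta r : R) : 0 <= r < 1 -> 0 < 1 - r * cos theta.
Proof. pose proof (COS_bound theta); nra. Qed.

Lemma ray_dist2_pos (theta r : R) :
  0 < 1 - r * cos theta -> 0 < ray_dist2 theta r.
Proof. unfold ray_dist2; intros H; nra. Qed.

Lemma is_derive_ray_dist2 (theta r : R) :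
  is_derive (ray_dist2 theta) r (2 * (r - cos theta)).
Proof.
unfold ray_dist2; auto_derive; trivial.
pose proof (sin2_cos2 theta) as H; unfold Rsqr in H.
transitivity (2 * (r * (sin theta * sin theta + cos theta * cos theta)
  - cos theta)); [ring | rewrite H; ring].
Qed.

Lemma is_derive_ray_angle (theta r : R) : 0 < 1 - r * cos theta ->
  is_derive (ray_angle theta) r (sin theta / ray_dist2 theta r).
Proof.
intros Hu; pose proof (ray_dist2_pos theta r Hu) as HD.
unfold ray_angle; auto_derive; [lra |].
unfold ray_dist2 in *; field; repeat split; nra.
Qed.

(** In the proof, [X + i Y] is the complex series [A + i B] divided by the polar
    form of [(1 - r e^(i theta))^alpha]. Both satisfy the same linear equation,
    so the quotient is constant, and it is 1 at [r = 0]. *)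
Lemma binomial_series_ray (alpha theta r : R) : 1 < alpha < 2 -> 0 <= r < 1 ->
  PSeries (binom_cos alpha theta) r
    = exp (alpha / 2 * ln (ray_dist2 theta r))
      * cos (alpha * ray_angle theta r) /\
  PSeries (binom_sin alpha theta) r
    = - (exp (alpha / 2 * ln (ray_dist2 theta r))
         * sin (alpha * ray_angle theta r)).
Proof.
intros Ha Hr.
set (A := PSeries (binom_cos alpha theta)).
set (B := PSeries (binom_sin alpha theta)).
set (D := ray_dist2 theta); set (phi := ray_angle theta).
set (X := fun t => exp (- (alpha / 2 * ln (D t)))
  * (A t * cos (alpha * phi t) - B t * sin (alpha * phi t))).
set (Y := fun t => exp (- (alpha / 2 * ln (D t)))
  * (A t * sin (alpha * phi t) + B t * cos (alpha * phi t))).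
assert (HXY : forall t, 0 <= t < 1 -> is_derive X t 0 /\ is_derive Y t 0).
{ intros t Ht.
  pose proof (ray_re_pos theta t Ht) as Hu.
  pose proof (ray_dist2_pos theta t Hu) as HD; fold D in HD.
  destruct (binomial_ODE alpha theta t Ha Ht) as [E1 E2].
  fold A B in E1, E2.
  set (dA := PSeries (PS_derive (binom_cos alpha theta)) t) in *.
  set (dB := PSeries (PS_derive (binom_sin alpha theta)) t) in *.
  assert (HA : is_derive A t dA)
    by (apply is_derive_PSeries, lt_CV_radius; trivial;
        now apply ex_series_binom_cos).
  assert (HB : is_derive B t dB)
    by (apply is_derive_PSeries, lt_CV_radius; trivial;
        now apply ex_series_binom_sin).
  pose proof (is_derive_ray_dist2 theta t) as HdD; fold D in HdD.
  pose proof (is_derive_ray_angle theta t Hu) as Hphi; fold D phi in Hphi.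
  pose proof (sin2_cos2 theta) as Hsc; unfold Rsqr in Hsc.
  set (s := sin theta) in *; set (c := cos theta) in *.
  set (u := 1 - t * c); set (v := t * s).
  assert (F1 : u * dA + v * dB = - alpha * (c * A t - s * B t))
    by (unfold u, v; lra).
  assert (F2 : u * dB - v * dA = - alpha * (s * A t + c * B t))
    by (unfold u, v; lra).
  assert (G1 : u * c - v * s = c - t).
  { transitivity (c - t * (s * s + c * c)); [unfold u, v | rewrite Hsc]; ring. }
  assert (G2 : u * s + v * c = s) by (unfold u, v; ring).
  (* [F1] and [F2] form a linear system in [dA], [dB] with matrix
     [[u, v], [- v, u]], whose determinant is [D t]; Cramer's rule solves it. *)
  assert (EA : dA = - alpha * ((c - t) * A t - s * B t) / D t).
  { apply Rmult_eq_reg_r with (D t); [| lra].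
    transitivity (u * (u * dA + v * dB) - v * (u * dB - v * dA));
      [unfold D, ray_dist2; fold s c u v; ring |].
    rewrite F1, F2.
    transitivity (- alpha * ((u * c - v * s) * A t - (u * s + v * c) * B t));
      [ring | rewrite G1, G2; field; lra]. }
  assert (EB : dB = - alpha * (s * A t + (c - t) * B t) / D t).
  { apply Rmult_eq_reg_r with (D t); [| lra].
    transitivity (v * (u * dA + v * dB) + u * (u * dB - v * dA));
      [unfold D, ray_dist2; fold s c u v; ring |].
    rewrite F1, F2.
    transitivity (- alpha * ((u * s + v * c) * A t + (u * c - v * s) * B t));
      [ring | rewrite G1, G2; field; lra]. }
  assert (UA : Derive (fun x => A x) t = dA) by exact (is_derive_unique A t _ HA).
  assert (UB : Derive (fun x => B x) t = dB) by exact (is_derive_unique B t _ HB).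
  assert (UD : Derive (fun x => D x) t = 2 * (t - c))
    by exact (is_derive_unique D t _ HdD).
  assert (Uphi : Derive (fun x => phi x) t = s / D t)
    by exact (is_derive_unique phi t _ Hphi).
  split; unfold X, Y; auto_derive;
    try (repeat split; trivial; eexists; eassumption);
    rewrite UA, UB, UD, Uphi, EA, EB; field; lra. }
assert (E0 : X r = 1 /\ Y r = 0).
{ assert (H0 : X 0 = 1 /\ Y 0 = 0).
  { unfold X, Y, A, B, D, phi, ray_dist2, ray_angle.
    rewrite !PSeries_0; unfold binom_cos, binom_sin.
    rewrite weight_w_0; simpl INR.
    replace ((1 - 0 * cos theta) ^ 2 + (0 * sin theta) ^ 2) with 1 by ring.
    replace (0 * sin theta / (1 - 0 * cos theta)) with 0 by field.
    rewrite ln_1, atan_0, !Rmult_0_r, Ropp_0, exp_0, Rmult_0_l, cos_0, sin_0.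
    split; ring. }
  destruct (proj1 Hr) as [Hr0 | <-]; [| exact H0].
  destruct H0 as [HX HY].
  split; [rewrite <- HX | rewrite <- HY]; symmetry; apply eq_is_derive; trivial;
    intros t Ht; apply HXY; lra. }
destruct E0 as [EX EY]; unfold X, Y in EX, EY.
fold (D r) (phi r).
rewrite exp_Ropp in EX, EY.
pose proof (exp_pos (alpha / 2 * ln (D r))) as HE.
set (E := exp (alpha / 2 * ln (D r))) in *.
set (C1 := cos (alpha * phi r)) in *; set (S1 := sin (alpha * phi r)) in *.
assert (HCS : S1 * S1 + C1 * C1 = 1) by exact (sin2_cos2 (alpha * phi r)).
assert (FX : A r * C1 - B r * S1 = E).
{ apply Rmult_eq_reg_l with (/ E); [rewrite EX; field | apply Rinv_neq_0_compat];
    lra. }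
assert (FY : A r * S1 + B r * C1 = 0).
{ apply Rmult_eq_reg_l with (/ E); [rewrite EY; ring | apply Rinv_neq_0_compat];
    lra. }
split.
- transitivity (A r * (S1 * S1 + C1 * C1)); [rewrite HCS; ring |].
  transitivity (C1 * (A r * C1 - B r * S1) + S1 * (A r * S1 + B r * C1));
    [ring | rewrite FX, FY; ring].
- transitivity (B r * (S1 * S1 + C1 * C1)); [rewrite HCS; ring |].
  transitivity (C1 * (A r * S1 + B r * C1) - S1 * (A r * C1 - B r * S1));
    [ring | rewrite FX, FY; ring].
Qed.

(** * The binomial series on the unit circle *)

Lemma at_left_1_unit_interval (P : R -> Prop) :
  (forall r, 0 <= r < 1 -> P r) -> at_left 1 P.
Proof.
intros H; exists (mkposreal 1 Rlt_0_1); intros y Hy Hlt.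
apply H; split; trivial.
unfold ball in Hy; simpl in Hy; unfold AbsRing_ball, abs, minus in Hy.
simpl in Hy; unfold plus, opp in Hy; simpl in Hy.
apply Rabs_def2 in Hy; lra.
Qed.

(** Abel's theorem as a summation tool: a closed form on [[0, 1)] that is
    continuous at 1 gives the sum of the series. *)
Lemma Series_lim_left_1 (a : nat -> R) (H : R -> R) : ex_series a ->
  (forall r, 0 <= r < 1 -> PSeries a r = H r) -> continuous H 1 ->
  is_series a (H 1).
Proof.
intros Ha HE Hc.
replace (H 1) with (Series a) by
 (apply (filterlim_locally_unique (F := at_left 1) (PSeries a));
  [now apply PSeries_lim_left_1 |
   apply filterlim_ext_loc with H;
   [apply at_left_1_unit_interval; intros r Hr; symmetry; now apply HE |
    apply (filterlim_filter_le_1 (F := locally 1)); [apply filter_le_within |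
      exact Hc]]]).
now apply Series_correct.
Qed.

Lemma ray_dist2_1 (theta : R) :
  ray_dist2 theta 1 = (2 * sin (theta / 2)) ^ 2.
Proof.
replace theta with (2 * (theta / 2)) at 1 by field.
unfold ray_dist2; rewrite cos_2a_sin, sin_2a.
pose proof (sin2_cos2 (theta / 2)) as H; unfold Rsqr in H.
set (s := sin (theta / 2)) in *; set (c := cos (theta / 2)) in *.
transitivity (4 * s ^ 2 * (s * s + c * c)); [ring | rewrite H; ring].
Qed.

(** The triangle [0, 1, e^(i theta)] is isosceles, so its angle at 1 is
    [(PI - theta) / 2]. *)
Lemma ray_angle_1 (theta : R) :
  0 < theta < 2 * PI -> ray_angle theta 1 = (PI - theta) / 2.
Proof.
intros Ht.
assert (Hs : 0 < sin (theta / 2)) by (apply sin_gt_0; lra).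
rewrite <- (atan_tan ((PI - theta) / 2)) by lra.
unfold ray_angle; f_equal; unfold tan.
replace ((PI - theta) / 2) with (PI / 2 - theta / 2) by field.
rewrite sin_shift, cos_shift.
replace theta with (2 * (theta / 2)) at 1 2 by field.
rewrite cos_2a_sin, sin_2a; field; split; nra.
Qed.

Lemma binomial_series_circle (alpha theta : R) :
  1 < alpha < 2 -> 0 < theta < 2 * PI ->
  is_series (binom_cos alpha theta)
    (Rpower (2 * sin (theta / 2)) alpha * cos (alpha / 2 * (theta - PI))) /\
  is_series (binom_sin alpha theta)
    (Rpower (2 * sin (theta / 2)) alpha * sin (alpha / 2 * (theta - PI))).
Proof.
intros Ha Ht.
assert (Hs : 0 < 2 * sin (theta / 2))
  by (apply Rmult_lt_0_compat; [lra | apply sin_gt_0; lra]).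
assert (Hu : 0 < 1 - 1 * cos theta).
{ replace theta with (2 * (theta / 2)) by field.
  rewrite cos_2a_sin; nra. }
assert (HD : 0 < ray_dist2 theta 1) by now apply ray_dist2_pos.
assert (EE : exp (alpha / 2 * ln (ray_dist2 theta 1))
  = Rpower (2 * sin (theta / 2)) alpha).
{ rewrite ray_dist2_1, ln_pow by trivial; unfold Rpower; f_equal.
  simpl; field. }
assert (Hex : ex_derive (ray_dist2 theta) 1 /\ ex_derive (ray_angle theta) 1).
{ split; eexists; [apply is_derive_ray_dist2 | now apply is_derive_ray_angle]. }
replace (alpha / 2 * (theta - PI)) with (- (alpha * ray_angle theta 1))
  by (rewrite ray_angle_1 by trivial; field).
rewrite cos_neg, sin_neg, <- EE; split.
- apply (Series_lim_left_1 _ (fun r => exp (alpha / 2 * ln (ray_dist2 theta r))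
    * cos (alpha * ray_angle theta r))).
  + now apply ex_series_binom_cos.
  + intros r Hr; now apply binomial_series_ray.
  + apply (ex_derive_continuous (V := R_NormedModule)); auto_derive; tauto.
- rewrite Ropp_mult_distr_r_reverse.
  apply (Series_lim_left_1 _ (fun r => - (exp (alpha / 2
    * ln (ray_dist2 theta r)) * sin (alpha * ray_angle theta r)))).
  + now apply ex_series_binom_sin.
  + intros r Hr; now apply binomial_series_ray.
  + apply (ex_derive_continuous (V := R_NormedModule)); auto_derive; tauto.
Qed.

(** * The symbol of the weighted operators *)

Definition cis (x : R) : C := (cos x, sin x).

Lemma cis_plus (x y : R) : cis (x + y) = (cis x * cis y)%C.
Proof.
unfold cis, Cmult; simpl; rewrite cos_plus, sin_plus.
f_equal; ring.
Qed.

Lemma is_series_pair (a b : nat -> R) (la lb : R) :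
  is_series a la -> is_series b lb ->
  is_series (fun k => (a k, b k) : C) ((la, lb) : C).
Proof.
intros Ha Hb.
apply filterlim_ext with (fun n => (sum_n a n, sum_n b n) : C).
{ intros n; induction n as [|n IH]; [now rewrite !sum_O |].
  now rewrite !sum_Sn, <- IH. }
apply filterlim_locally; intros eps.
apply filter_and.
- exact (proj1 (filterlim_locally _ _) Ha eps).
- exact (proj1 (filterlim_locally _ _) Hb eps).
Qed.

Lemma is_series_shift (a : nat -> C) (l : C) : is_series a l ->
  is_series (fun k => match k with O => RtoC 0 | S m => a m end) l.
Proof.
intros Ha; apply is_series_decr_1.
replace (plus l _) with l; [exact Ha |].
unfold plus, opp; simpl; ring.
Qed.

(** The weights [g] are the convolution of [w] with [(l1, l2, l3)], and
    generating functions turn convolution into multiplication. *)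
Lemma weight_g_generating_function (alpha l1 l2 l3 x : R) (W : C) :
  is_series (fun k => RtoC (weight_w alpha k) * cis (INR k * x))%C W ->
  is_series (fun k => RtoC (weight_g alpha l1 l2 l3 k) * cis (INR k * x))%C
    ((RtoC l1 + RtoC l2 * cis x + RtoC l3 * cis (2 * x)) * W)%C.
Proof.
intros HW.
pose proof (is_series_shift _ _ HW) as HW1.
pose proof (is_series_shift _ _ HW1) as HW2.
eapply is_series_ext.
2: { replace ((_ + _ + _) * W)%C with (plus (plus (scal (RtoC l1) W)
       (scal (RtoC l2 * cis x)%C W)) (scal (RtoC l3 * cis (2 * x))%C W))
       by (unfold plus, scal; simpl; unfold mult; simpl; ring).
     exact (is_series_plus _ _ _ _
       (is_series_plus _ _ _ _ (is_series_scal_l _ _ _ HW)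
         (is_series_scal_l _ _ _ HW1))
       (is_series_scal_l _ _ _ HW2)). }
intros k; unfold plus, scal; simpl; unfold mult; simpl.
destruct k as [|[|m]]; cbv beta iota; unfold weight_g.
- rewrite RtoC_mult; ring.
- replace (INR 1 * x) with (x + INR 0 * x) by (simpl; ring).
  rewrite cis_plus, RtoC_plus, !RtoC_mult; ring.
- replace (INR (S (S m)) * x) with (2 * x + INR m * x)
    by (rewrite !S_INR; ring).
  replace (INR (S m) * x) with (x + INR m * x) by (rewrite !S_INR; ring).
  replace (2 * x) with (x + x) by ring.
  rewrite !cis_plus, !RtoC_plus, !RtoC_mult; ring.
Qed.

(** The real part of
    [(l1 e^(-i theta) + l2 + l3 e^(i theta)) (A + i B)]. *)
Definition symbol_re (theta l1 l2 l3 A B : R) : R :=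
  l1 * (A * cos theta + B * sin theta) + l2 * A
  + l3 * (A * cos theta - B * sin theta).

(** For [theta > 0] the real part is [Q theta], by the addition formulas. For
    [theta = 0] it is the sum of the weights [w_k], a limit of nonpositive
    partial sums. *)
Lemma symbol_re_nonpos (alpha l1 l2 l3 theta : R) :
  1 < alpha < 2 -> l1 + l2 + l3 = 1 -> 0 <= theta <= PI ->
  Q theta alpha l1 l2 l3 <= 0 ->
  exists A B : R, is_series (binom_cos alpha theta) A /\
    is_series (binom_sin alpha theta) B /\
    symbol_re theta l1 l2 l3 A B <= 0.
Proof.
intros Ha Hl Ht HQ.
destruct (proj1 Ht) as [Ht0 | <-].
- destruct (binomial_series_circle alpha theta Ha) as [HA HB]; [lra |].
  do 2 eexists; repeat split; [exact HA | exact HB |].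
  apply Rle_trans with (2 := HQ), Req_le.
  assert (Hs : 0 < sin (theta / 2)) by (apply sin_gt_0; lra).
  unfold symbol_re, Q, real_pow.
  destruct (Req_EM_T _ 0) as [H0 | _]; [lra |].
  rewrite cos_minus, cos_plus; ring.
- exists (Series (binom_cos alpha 0)), (Series (binom_sin alpha 0)).
  repeat split; try apply Series_correct.
  + now apply ex_series_binom_cos.
  + now apply ex_series_binom_sin.
  + unfold symbol_re; rewrite cos_0, sin_0.
    replace (_ + _) with ((l1 + l2 + l3) * Series (binom_cos alpha 0)) by ring.
    rewrite Hl, Rmult_1_l.
    change 0 with (real (Finite 0)).
    apply (is_lim_seq_le (fun n => sum_n (weight_w alpha) (S n)) (fun _ => 0)
      (Series (binom_cos alpha 0)) 0).
    * intros n; now apply sum_weight_w_le_0.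
    * apply (is_lim_seq_incr_1 (sum_n (weight_w alpha))).
      apply is_series_ext with (binom_cos alpha 0).
      { intros k; unfold binom_cos; now rewrite Rmult_0_r, cos_0, Rmult_1_r. }
      now apply Series_correct, ex_series_binom_cos.
    * apply is_lim_seq_const.
Qed.

Lemma is_series_binom_opp (alpha theta A B : R) :
  is_series (binom_cos alpha theta) A -> is_series (binom_sin alpha theta) B ->
  is_series (binom_cos alpha (- theta)) A /\
  is_series (binom_sin alpha (- theta)) (- B).
Proof.
intros HA HB; split.
- revert HA; apply is_series_ext; intros k; unfold binom_cos.
  now rewrite Ropp_mult_distr_r_reverse, cos_neg.
- apply is_series_ext with (2 := is_series_opp _ _ HB).
  intros k; unfold binom_sin, opp; simpl.
  rewrite (Ropp_mult_distr_r_reverse _ theta), sin_neg; ring.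
Qed.

(** The change [theta -> - theta] conjugates the symbol and leaves its real part
    alone. *)
Lemma symbol_re_nonpos_full (alpha l1 l2 l3 theta : R) :
  1 < alpha < 2 -> l1 + l2 + l3 = 1 ->
  (forall x, 0 <= x <= PI -> Q x alpha l1 l2 l3 <= 0) ->
  - PI <= theta <= PI ->
  exists A B : R, is_series (binom_cos alpha theta) A /\
    is_series (binom_sin alpha theta) B /\
    symbol_re theta l1 l2 l3 A B <= 0.
Proof.
intros Ha Hl HQ Ht.
destruct (Rle_dec 0 theta) as [H0 | H0].
- apply symbol_re_nonpos; trivial; [lra | apply HQ; lra].
- destruct (symbol_re_nonpos alpha l1 l2 l3 (- theta)) as (A & B & HA & HB & H);
    trivial; [lra | apply HQ; lra |].
  destruct (is_series_binom_opp _ _ _ _ HA HB) as [HA' HB'].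
  rewrite Ropp_involutive in HA', HB'.
  exists A, (- B); repeat split; trivial.
  revert H; unfold symbol_re; rewrite cos_neg, sin_neg; lra.
Qed.

Lemma fourier_mode_shift (rho : C) (theta : R) (n : nat) (j m : Z) :
  fourier_mode rho theta n (j + m)
  = (fourier_mode rho theta n j * cis (IZR m * theta))%C.
Proof.
unfold fourier_mode; fold (cis (IZR (j + m) * theta)) (cis (IZR j * theta)).
rewrite plus_IZR, Rmult_plus_distr_r, cis_plus; ring.
Qed.

(** The left sum involves [e^(-i k theta)] and the right one [e^(i k theta)];
    their symbols are conjugate, so the imaginary parts cancel and the
    total is real: diffusion does not shift the phase of a mode. *)
Lemma fourier_mode_sums (alpha l1 l2 l3 theta A B : R) :
  is_series (binom_cos alpha theta) A -> is_series (binom_sin alpha theta) B ->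
  exists GL GR : C,
    (GL + GR)%C = RtoC (2 * symbol_re theta l1 l2 l3 A B) /\
    forall (rho : C) (n : nat) (j : Z),
      is_series (left_term (weight_g alpha l1 l2 l3)
        (fourier_mode rho theta n) j) (fourier_mode rho theta n j * GL)%C /\
      is_series (right_term (weight_g alpha l1 l2 l3)
        (fourier_mode rho theta n) j) (fourier_mode rho theta n j * GR)%C.
Proof.
intros HA HB.
destruct (is_series_binom_opp _ _ _ _ HA HB) as [HA' HB'].
set (M := fun x => (RtoC l1 + RtoC l2 * cis x + RtoC l3 * cis (2 * x))%C).
assert (HG : forall x a b : R, is_series (binom_cos alpha x) a ->
  is_series (binom_sin alpha x) b ->
  is_series (fun k => RtoC (weight_g alpha l1 l2 l3 k) * cis (INR k * x))%C
    (M x * (a, b))%C).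
{ intros x a b H H'; apply weight_g_generating_function.
  apply is_series_ext with (2 := is_series_pair _ _ _ _ H H').
  intros k; unfold binom_cos, binom_sin, cis, Cmult, RtoC; simpl.
  f_equal; ring. }
pose proof (HG _ _ _ HA HB) as HGR; pose proof (HG _ _ _ HA' HB') as HGL.
set (gR := (M theta * (A, B))%C) in HGR.
set (gL := (M (- theta)%R * (A, (- B)%R))%C) in HGL.
exists (cis theta * gL)%C, (cis (- theta) * gR)%C; split.
- unfold gL, gR, M, symbol_re.
  replace (2 * - theta) with (- theta + - theta) by ring.
  replace (2 * theta) with (theta + theta) by ring.
  rewrite !cis_plus.
  assert (E : (cis theta * cis (- theta))%C = 1).
  { rewrite <- cis_plus, Rplus_opp_r; unfold cis; now rewrite cos_0, sin_0. }
  transitivity ((RtoC l1 * cis theta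
      + RtoC l2 * (cis theta * cis (- theta))
      + RtoC l3 * cis (- theta) * (cis theta * cis (- theta))) * (A, (- B)%R)
    + (RtoC l1 * cis (- theta) + RtoC l2 * (cis theta * cis (- theta))
      + RtoC l3 * cis theta * (cis theta * cis (- theta))) * (A, B))%C;
    [ring | rewrite E].
  unfold cis; rewrite cos_neg, sin_neg.
  unfold Cplus, Cmult, RtoC; simpl; f_equal; ring.
- intros rho n j; split.
  + replace (fourier_mode rho theta n j * (cis theta * gL))%C
      with (scal (fourier_mode rho theta n j * cis theta)%C gL)
      by (unfold scal; simpl; unfold mult; simpl; ring).
    apply is_series_ext with (2 := is_series_scal_l _ _ _ HGL).
    intros k; unfold left_term, scal; simpl; unfold mult; simpl.
    replace (j - Z.of_nat k + 1)%Z with (j + (1 - Z.of_nat k))%Z by ring.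
    rewrite fourier_mode_shift, minus_IZR, <- INR_IZR_INZ.
    replace ((1 - INR k) * theta) with (theta + INR k * - theta) by ring.
    rewrite cis_plus; ring.
  + replace (fourier_mode rho theta n j * (cis (- theta) * gR))%C
      with (scal (fourier_mode rho theta n j * cis (- theta))%C gR)
      by (unfold scal; simpl; unfold mult; simpl; ring).
    apply is_series_ext with (2 := is_series_scal_l _ _ _ HGR).
    intros k; unfold right_term, scal; simpl; unfold mult; simpl.
    replace (j + Z.of_nat k - 1)%Z with (j + (Z.of_nat k - 1))%Z by ring.
    rewrite fourier_mode_shift, minus_IZR, <- INR_IZR_INZ.
    replace ((INR k - 1) * theta) with (- theta + INR k * theta) by ring.
    rewrite cis_plus; ring.
Qed.

(** * The amplification factor *)

(** The scheme at every node and every time level is the same scalar equation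
    multiplied by [fourier_mode rho theta n j]. At [n = 0], [j = 0] this factor
    is 1, whatever [rho] is, so that the equation can be recovered even for
    [rho = 0]. *)
Lemma amplification_factor_iff (alpha : R) (g : nat -> R)
    (vx dx tau h theta : R) (GL GR rho : C) :
  (forall (rho : C) (n : nat) (j : Z),
     is_series (left_term g (fourier_mode rho theta n) j)
       (fourier_mode rho theta n j * GL)%C /\
     is_series (right_term g (fourier_mode rho theta n) j)
       (fourier_mode rho theta n j * GR)%C) ->
  let c : C := RtoC (dx / (2 * Rpower h alpha)) in
  let D : C := (RtoC vx * ((cis theta - cis (- theta)) / RtoC (4 * h))
                - c * (GL + GR))%C in
  is_amplification_factor alpha g vx dx tau h theta rho <->
  (rho * (/ RtoC tau + D) = / RtoC tau - D)%C.
Proof.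
intros HG c D.
assert (Hid : forall n j, let X := fourier_mode rho theta n j in
  cn_identity alpha vx dx tau h (fourier_mode rho theta n)
    (fourier_mode rho theta (S n)) j (X * GL) (X * GR)
    (fourier_mode rho theta (S n) j * GL) (fourier_mode rho theta (S n) j * GR)
    (RtoC 0) (RtoC 0) <->
  (X * (rho * (/ RtoC tau + D) - (/ RtoC tau - D)) = 0)%C).
{ intros n j X.
  assert (HS : forall i, fourier_mode rho theta (S n) i
    = (rho * fourier_mode rho theta n i)%C)
    by (intros i; unfold fourier_mode; rewrite Cpow_S; ring).
  unfold cn_identity; fold c.
  rewrite !HS; unfold Z.sub; rewrite !fourier_mode_shift; fold X.
  replace (IZR 1 * theta) with theta by ring.
  replace (IZR (- (1)) * theta) with (- theta) by (simpl; ring).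
  rewrite Ceq_minus.
  assert (E : forall x y : C, x = y -> (x = RtoC 0 <-> y = RtoC 0))
    by (intros x y ->; tauto).
  apply E; unfold D, Cdiv; ring. }
split.
- intros H; destruct (H 0%nat 0%Z) as (L0 & R0 & L1 & R1 & H1 & H2 & H3 & H4 & H5).
  destruct (HG rho 0%nat 0%Z) as [K1 K2], (HG rho 1%nat 0%Z) as [K3 K4].
  rewrite (is_series_inj _ _ _ H1 K1), (is_series_inj _ _ _ H2 K2),
    (is_series_inj _ _ _ H3 K3), (is_series_inj _ _ _ H4 K4) in H5.
  apply Hid in H5; apply Ceq_minus; rewrite <- H5.
  unfold fourier_mode; rewrite Rmult_0_l, cos_0, sin_0; simpl Cpow.
  change (1, 0) with (RtoC 1); ring.
- intros H n j.
  destruct (HG rho n j) as [K1 K2], (HG rho (S n) j) as [K3 K4].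
  do 4 eexists; repeat split; [exact K1 | exact K2 | exact K3 | exact K4 |].
  apply Hid; rewrite H; ring.
Qed.

(** [a - p - i s] and [a + p + i s] have imaginary parts of equal size, and
    [|a - p| <= a + p]. *)
Lemma Cayley_contraction (a p s : R) : 0 < a -> 0 <= p ->
  ((a + p, s) : C) <> RtoC 0 /\ Cmod (((a - p)%R, (- s)%R) / ((a + p)%R, s))%C <= 1.
Proof.
intros Ha Hp.
assert (H0 : ((a + p, s) : C) <> RtoC 0)
  by (intros E; apply (f_equal fst) in E; simpl in E; lra).
split; trivial.
rewrite Cmod_div by trivial.
apply Rmult_le_reg_r with (Cmod (a + p, s)); [now apply Cmod_gt_0 |].
unfold Rdiv; rewrite Rmult_assoc, Rinv_l, Rmult_1_r, Rmult_1_l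
  by now apply Rgt_not_eq, Cmod_gt_0.
unfold Cmod; simpl; apply sqrt_le_1_alt; nra.
Qed.

Lemma lambda_sum (alpha l1 l2 l3 : R) :
  in_S1 alpha l1 l2 l3 \/ in_S2 alpha l1 l2 l3 \/ in_S3 alpha l1 l2 l3 ->
  l1 + l2 + l3 = 1.
Proof. unfold in_S1, in_S2, in_S3; lra. Qed.

Theorem theorem5 :
  forall lambda1 lambda2 lambda3 : R -> R,
  (forall alpha : R, 1 < alpha < 2 ->
     in_S1 alpha (lambda1 alpha) (lambda2 alpha) (lambda3 alpha) \/
     in_S2 alpha (lambda1 alpha) (lambda2 alpha) (lambda3 alpha) \/
     in_S3 alpha (lambda1 alpha) (lambda2 alpha) (lambda3 alpha)) ->
  (forall theta alpha : R, 0 <= theta <= PI -> 1 < alpha < 2 ->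
     Q theta alpha (lambda1 alpha) (lambda2 alpha) (lambda3 alpha) <= 0) ->
  forall alpha vx dx : R, 1 < alpha < 2 -> 0 < vx -> 0 < dx ->
  unconditionally_von_neumann_stable alpha
    (weight_g alpha (lambda1 alpha) (lambda2 alpha) (lambda3 alpha)) vx dx.
Proof.
intros lambda1 lambda2 lambda3 Hin HQ alpha vx dx Ha Hv Hd tau h Htau Hh
  theta Htheta.
destruct (symbol_re_nonpos_full alpha (lambda1 alpha) (lambda2 alpha)
  (lambda3 alpha) theta) as (A & B & HA & HB & HP); trivial.
{ now apply (lambda_sum alpha), Hin. }
{ intros x Hx; now apply HQ. }
destruct (fourier_mode_sums alpha (lambda1 alpha) (lambda2 alpha)
  (lambda3 alpha) theta A B HA HB) as (GL & GR & HGsum & HG).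
set (P := symbol_re _ _ _ _ _ _) in *.
pose proof (fun rho => amplification_factor_iff alpha _ vx dx tau h _ _ _ rho HG)
  as Hamp.
cbv zeta in Hamp; rewrite HGsum in Hamp.
set (c := dx / (2 * Rpower h alpha)) in *.
assert (Hc : 0 < c).
{ apply Rdiv_lt_0_compat; [trivial |].
  apply Rmult_lt_0_compat; [lra | apply exp_pos]. }
set (p := - (c * (2 * P))).
set (s := vx * sin theta / (2 * h)).
assert (HD : (RtoC vx * ((cis theta - cis (- theta)) / RtoC (4 * h))
  - RtoC c * RtoC (2 * P) = (p, s))%C).
{ unfold cis; rewrite cos_neg, sin_neg.
  unfold p, s, Cdiv; rewrite <- RtoC_inv by lra.
  unfold Cminus, Cplus, Copp, Cmult, RtoC; simpl.
  f_equal; field; lra. }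
assert (Hiff : forall rho,
  is_amplification_factor alpha
    (weight_g alpha (lambda1 alpha) (lambda2 alpha) (lambda3 alpha))
    vx dx tau h theta rho <->
  (rho * ((/ tau + p)%R, s))%C = (/ tau - p, - s)).
{ intros rho; rewrite Hamp, HD, <- RtoC_inv by lra.
  replace (RtoC (/ tau) + (p, s))%C with ((/ tau + p, s) : C)
    by (unfold Cplus, RtoC; simpl; f_equal; ring).
  replace (RtoC (/ tau) - (p, s))%C with ((/ tau - p, - s) : C)
    by (unfold Cminus, Cplus, Copp, RtoC; simpl; f_equal; ring).
  reflexivity. }
destruct (Cayley_contraction (/ tau) p s) as [Hnz Hle];
  [now apply Rinv_0_lt_compat | unfold p; nra |].
assert (Hsol : forall rho,
  is_amplification_factor alpha
    (weight_g alpha (lambda1 alpha) (lambda2 alpha) (lambda3 alpha))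
    vx dx tau h theta rho <->
  rho = (((/ tau - p)%R, (- s)%R) / ((/ tau + p)%R, s))%C).
{ intros rho; rewrite Hiff; split; intros H.
  - rewrite <- H; field; exact Hnz.
  - rewrite H; field; exact Hnz. }
split.
- eexists; split; [now apply Hsol | intros rho H; symmetry; now apply Hsol].
- intros rho H; apply Hsol in H; now rewrite H.
Qed.
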